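(* If $(t_k)$ and $(\tau_k)$, $k=0,1,2,\ldots$, are a binomial-transform pair of the first kind, then so are the sequences \[ a_k=\sum_{j=1}^{k-1+\delta_{k0}}t_{j-1}\quad\text{and}\quad \alpha_k=\sum_{j=1}^{k-1+\delta_{k0}}\tau_{j-1},\qquad k=0,1,2,\ldots; \] so that, for every positive integer $n$, \[ \sum_{k=1}^n(-1)^k\binom nk\sum_{j=1}^{k-1}t_{j-1}=\sum_{k=1}^{n-1}\tau_{k-1}. \]
   Context: Two sequences $(t_k)_{k\ge0}$ and $(\tau_k)_{k\ge0}$ of complex numbers form a binomial-transform pair of the first kind if $\tau_n=\sum_{k=0}^n(-1)^k\binom nk t_k$ for every non-negative integer $n$. $\delta_{ij}$ is the Kronecker delta; an empty sum (upper limit smaller than lower limit) equals $0$. *)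

(* Defs.v *)
From mathcomp Require Import all_boot all_order all_algebra.
From mathcomp Require Import complex.
From mathcomp Require Import reals.

Set Implicit Arguments.
Unset Strict Implicit.
Unset Printing Implicit Defensive.

Import GRing.Theory.
Local Open Scope ring_scope.

Definition binomial_pair1 (R : realType) (t tau : nat -> R[i]) : Prop :=
  forall n : nat,
    tau n = \sum_(0 <= k < n.+1) (-1) ^+ k * 'C(n, k)%:R * t k.

(* The sum of t_{j-1} for 1 <= j <= k - 1 + delta_{k0}.  The delta is added    *)
(* before the truncated subtraction of 1, so that the upper limit at k = 0 is *)
(* 0 (with k - 1 + (k == 0) it would be 1).                                   *)
Definition shifted_sum (R : realType) (t : nat -> R[i]) (k : nat) : R[i] :=
  \sum_(1 <= j < (k + (k == 0%N) - 1).+1) t (j - 1)%N.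

(* Main.v *)
(* Let B a denote the binomial transform of a.  Pascal's rule gives            *)
(* B a (n+1) - B a n = - B (S a) n, where S is the left shift.  If b is the   *)
(* sequence of partial sums of t, then S b = b + t, so B b (m+1) = - B t m;   *)
(* and if S a = b, a second use of Pascal's rule gives                        *)
(* B a (m+2) - B a (m+1) = B t m, which telescopes from B a 1 = 0.            *)

Require Import Defs.
From mathcomp Require Import all_boot all_order all_algebra.
From mathcomp Require Import complex.
From mathcomp Require Import reals.

Set Implicit Arguments.
Unset Strict Implicit.
Unset Printing Implicit Defensive.

Import GRing.Theory.
Local Open Scope ring_scope.

(** Pascal's rule ([binomial_transformS]) reads B S = (1 - S) B, so B commutes with S (S - 1), which
    is invariant under S -> 1 - S. The sequence a is determined by a 0 = a 1 = 0 and S (S - 1) a =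
    t, hence B a solves the same problem with B t in place of t ([binomial_transform_psum_pred]). *)

Definition binomial_transform (A : pzRingType) (a : nat -> A) (n : nat) : A :=
  \sum_(0 <= k < n.+1) (-1) ^+ k * 'C(n, k)%:R * a k.

Lemma eq_binomial_transform (A : pzRingType) (a b : nat -> A) :
  a =1 b -> binomial_transform a =1 binomial_transform b.
Proof. by move=> eq_ab n; apply: eq_bigr => k _; rewrite eq_ab. Qed.

Lemma binomial_transformD (A : pzRingType) (a b : nat -> A) n :
  binomial_transform (fun k => a k + b k) n =
  binomial_transform a n + binomial_transform b n.
Proof.
by rewrite -big_split; apply: eq_bigr => k _; rewrite mulrDr.
Qed.

Lemma binomial_transformS (A : pzRingType) (a : nat -> A) n :
  binomial_transform a n.+1 =
  binomial_transform a n - binomial_transform (fun k => a k.+1) n.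
Proof.
(* Since 'C(n, n.+1) = 0, padding by one term aligns the ranges for Pascal's rule. *)
have -> : binomial_transform a n =
    \sum_(0 <= k < n.+2) (-1) ^+ k * 'C(n, k)%:R * a k.
  by rewrite [RHS]big_nat_recr //= bin_small // mulr0 mul0r addr0.
rewrite /binomial_transform big_nat_recl // [in RHS]big_nat_recl // !bin0.
rewrite -addrA -sumrB; congr (_ + _); apply: eq_bigr => k _.
by rewrite binS natrD mulrDr mulrDl exprS !mulN1r !mulNr.
Qed.

Lemma binomial_transform_psum (A : pzRingType) (t : nat -> A) n :
  binomial_transform (fun k => \sum_(0 <= i < k) t i) n.+1 =
  - binomial_transform t n.
Proof.
rewrite binomial_transformS.
under [X in _ - X]eq_binomial_transform => k do rewrite big_nat_recr //=.
by rewrite binomial_transformD opprD addNKr.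
Qed.

Lemma binomial_transform_psum_pred (A : pzRingType) (t : nat -> A) n :
  binomial_transform (fun k => \sum_(0 <= i < k.-1) t i) n =
  \sum_(0 <= i < n.-1) binomial_transform t i.
Proof.
case: n => [|n] /=; first by rewrite /binomial_transform big_nat1 !big_geq ?mulr0.
(* Induction starts at index 1, because [binomial_transform_psum] speaks only of successor
   indices. *)
elim: n => [|n IHn].
  by rewrite /binomial_transform !big_nat_recr ?big_geq //= !mulr0 !addr0.
by rewrite binomial_transformS IHn /= binomial_transform_psum opprK big_nat_recr.
Qed.

Lemma sum_subn1 (A : nmodType) (t : nat -> A) k :
  \sum_(1 <= j < k) t (j - 1)%N = \sum_(0 <= i < k.-1) t i.
Proof.
case: k => [|k]; first by rewrite !big_geq.
by rewrite big_add1; apply: eq_bigr => i _; rewrite subn1.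
Qed.

(** Truncation, 0.-1 = 0, absorbs the Kronecker delta. *)
Lemma shifted_sumE (R : realType) (t : nat -> R[i]) k :
  shifted_sum t k = \sum_(0 <= i < k.-1) t i.
Proof. by rewrite /shifted_sum sum_subn1; case: k => [|k] //=; rewrite addn0 subn1. Qed.

Theorem theorem15 (R : realType) (t tau : nat -> R[i])
  (htau : binomial_pair1 t tau) :
  binomial_pair1 (shifted_sum t) (shifted_sum tau) /\
  (forall n : nat, (0 < n)%N ->
     \sum_(1 <= k < n.+1)
        (-1) ^+ k * 'C(n, k)%:R * (\sum_(1 <= j < k) t (j - 1)%N)
     = \sum_(1 <= k < n) tau (k - 1)%N).
Proof.
have psumE n : binomial_transform (fun k => \sum_(0 <= i < k.-1) t i) n =
    \sum_(0 <= i < n.-1) tau i.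
  rewrite binomial_transform_psum_pred.
  by apply: eq_bigr => i _; rewrite htau.
split=> [n|n n_gt0].
  rewrite shifted_sumE -psumE.
  by apply: eq_bigr => k _; rewrite shifted_sumE.
rewrite sum_subn1 -psumE /binomial_transform [RHS]big_ltn //.
(* The term k = 0 vanishes: its inner sum is empty. *)
rewrite [in X in _ = X + _]big_geq // mulr0 add0r.
by apply: eq_bigr => k _; rewrite sum_subn1.
Qed.
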